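(* Let $H$ be a real separable Hilbert space and let $\phi=\phi_1+\phi_2:H\to(-\infty,\infty]$ have compact sublevels, where $\phi_1:H\to(-\infty,\infty]$ is convex, proper, lower semicontinuous with $\partial\phi_1$ single-valued, and $\phi_2\in C^{1,\alpha}_{\rm loc}(H)$ for $\alpha\in(0,1]$. Let $\tau_i>0$ be the time step and let $u_{i-1}\in D(\partial\phi)$ be given with $\partial\phi(u_{i-1})\ne0$. Then there exists $u_i\in D(\partial\phi)$ with $u_i\neq u_{i-1}$ and $$G_i(u_i,u_{i-1})\le\frac{L}{1+\alpha}\|u_i-u_{i-1}\|^{1+\alpha},$$ where $L$ is the Hölder constant of $\mathrm{D}\phi_2$. In particular, the relation $$\phi(u_i)+\frac{\tau_i}{2}\left\|\frac{u_i-u_{i-1}}{\tau_i}\right\|^2+\frac{\tau_i}{2}\|\partial\phi(u_i)\|^2=\phi(u_{i-1})+\rho_i$$ can be solved with $\rho_i\le L\|u_i-u_{i-1}\|^{1+\alpha}/(1+\alpha)$. In case $\phi$ is convex, namely $\phi_2=0$, and $\|\partial\phi\|$ is strongly continuous along segments in $D(\partial\phi)$, one can find $u_i$ such that $G_i(u_i,u_{i-1})=0$.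
   Context: $H$ has scalar product $(\cdot,\cdot)$ and norm $\|\cdot\|$. The Fréchet subdifferential $\partial\phi(u)$ at $u$ with $\phi(u)<\infty$ is the set of $\xi\in H$ with $\liminf_{v\to u}\frac{\phi(v)-\phi(u)-(\xi,v-u)}{\|v-u\|}\ge0$; here $\partial\phi=\partial\phi_1+\mathrm{D}\phi_2$, where $\partial\phi_1$ is the subdifferential of convex analysis and $\mathrm{D}\phi_2$ the Fréchet gradient. $D(\partial\phi)=\{u\in H:\partial\phi(u)\ne\emptyset\}=D(\partial\phi_1)$. That $\partial\phi_1$ is single-valued means $\partial\phi_1(u)$ is a singleton for all $u\in D(\partial\phi_1)$; then $\partial\phi(u)$ is identified with its unique element. Compact sublevels means that the sets $\{u\in H:\phi(u)\le c\}$, $c\in\mathbb{R}$, are compact in the norm topology. $C^{1,\alpha}_{\rm loc}(H)$ is the set of $C^1$ functions on $H$ with locally $\alpha$-Hölder continuous gradient. The functional $G_i:D(\partial\phi)\times D(\partial\phi)\to(-\infty,\infty]$ is $$G_i(u,v)=\phi(u)+\frac{\tau_i}{2}\left\|\frac{u-v}{\tau_i}\right\|^2+\frac{\tau_i}{2}\|\partial\phi(u)\|^2-\phi(v).$$ Strong continuity of $\|\partial\phi\|$ along segments in $D(\partial\phi)$ means: for all $x,y\in D(\partial\phi)$ the map $\lambda\in[0,1]\mapsto\|\partial\phi(\lambda x+(1-\lambda)y)\|$ is continuous. *)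

(* Defs.v *)
From mathcomp Require Export all_boot all_order all_algebra.
From mathcomp Require Export sesquilinear.
From mathcomp Require Export all_classical all_reals all_analysis.

Set Implicit Arguments.
Unset Strict Implicit.
Unset Printing Implicit Defensive.

Import Order.TTheory GRing.Theory Num.Theory.
Import numFieldNormedType.Exports.

Local Open Scope classical_set_scope.
Local Open Scope ring_scope.

Definition separable_space (T : topologicalType) : Prop :=
  exists2 A : set T, countable A & dense A.

Section ConvexAnalysis.
Context {R : realType} {H : completeNormedModType R}.
Implicit Types (ip : H -> H -> R) (phi : H -> \bar R).

Local Open Scope ereal_scope.

Definition proper_fun phi : Prop :=
  (forall u, phi u != -oo) /\ (exists u, phi u < +oo).

(* In [\bar R], 0 * +oo = 0: at t = 0 and t = 1 the inequality is an
   equality, also at points where [phi] is +oo. *)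
Definition convex_efun phi : Prop :=
  forall (x y : H) (t : R), (0 <= t <= 1)%R ->
    phi (t *: x + (1 - t) *: y)%R <= t%:E * phi x + (1 - t)%:E * phi y.

Definition compact_sublevels phi : Prop :=
  forall c : R, compact [set u | phi u <= c%:E].

Definition convex_subdiff ip phi (u : H) : set H :=
  [set xi | phi u < +oo /\
    forall v, phi u + (ip xi (v - u)%R)%:E <= phi v].

(* Single-valued in the sense of multivalued operators: at most one value,
   so exactly one on the domain. *)
Definition single_valued (A : H -> set H) : Prop :=
  forall u, A u !=set0 -> exists xi, A u = [set xi].

Definition frechet_subdiff ip phi (u : H) : set H :=
  [set xi | phi u < +oo /\
    0 <= limf_einf
      (fun v : H => (phi v - phi u - (ip xi (v - u)%R)%:E) * (`|v - u|^-1)%:E)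
      u^'].

Definition dom_subdiff ip phi : set H :=
  [set u | frechet_subdiff ip phi u !=set0].

(* The unique element of the subdifferential when it is a singleton;
   0 (junk) outside of [dom_subdiff]. *)
Definition subgrad ip phi (u : H) : H := xget 0%R (frechet_subdiff ip phi u).

(* The norm of the subgradient, with value +oo outside of [dom_subdiff]. *)
Definition subgrad_norm ip phi (u : H) : \bar R :=
  if `[< dom_subdiff ip phi u >] then `|subgrad ip phi u|%R%:E else +oo.

(* Only meaningful for [u] and [v] in [dom_subdiff ip phi]; in particular
   [phi v] is then finite. *)
Definition G ip phi (tau : R) (u v : H) : \bar R :=
  phi u + (tau / 2 * `|tau^-1 *: (u - v)| ^+ 2)%R%:E
        + (tau / 2 * `|subgrad ip phi u| ^+ 2)%R%:E - phi v.

End ConvexAnalysis.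

Section Holder.
Context {R : realType} {V W : normedModType R}.

Definition holder_on (A : set V) (alpha L : R) (f : V -> W) : Prop :=
  0 <= L /\
  forall x y, A x -> A y -> `|f x - f y| <= L * `|x - y| `^ alpha.

Definition locally_holder (alpha : R) (f : V -> W) : Prop :=
  forall x : V, exists2 U, nbhs x U & exists L, holder_on U alpha L f.

(* The union of the segments joining the points of [A]; it is contained in
   the convex hull of [A]. *)
Definition segments (A : set V) : set V :=
  [set z | exists x y (t : R),
    [/\ A x, A y, 0 <= t <= 1 & z = t *: x + (1 - t) *: y]].

End Holder.

(* [f] is of class C^{1,alpha}_loc and [Df] is its gradient for [ip]. *)
Definition C1holder_loc {R : realType} {H : completeNormedModType R}
    (ip : H -> H -> R) (alpha : R) (f : H -> R) (Df : H -> H) : Prop :=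
  [/\ forall u, is_diff u f (ip (Df u)),
      continuous Df
    & locally_holder alpha Df].

(* Main.v *)
Require Import Defs.
From mathcomp Require Import ring lra.

(* The new point is the implicit Euler step: u minimizes
   phi + |. - u0|^2 / (2 tau), so that xi = (u0 - u) / tau is the subgradient
   of phi at u. The subgradient inequality for the convex part phi1 and the
   first order Hoelder estimate for phi2, both based at u and evaluated at u0,
   give phi(u) + |u - u0|^2 / tau <= phi(u0) + L |u - u0|^(1+alpha) / (1+alpha),
   and |u - u0|^2 / tau is the sum of the two quadratic terms of G. In the
   convex case G(u, u0) <= 0 < G(u0, u0), and an intermediate value argument
   along the segment from u to u0 gives a zero of G(., u0). *)

Set Implicit Arguments.
Unset Strict Implicit.
Unset Printing Implicit Defensive.

Import Order.TTheory GRing.Theory Num.Theory.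
Import numFieldNormedType.Exports.

Local Open Scope classical_set_scope.
Local Open Scope ring_scope.

(** * Cauchy-Schwarz and first order estimates for differentiable functions *)

Lemma dot_le_norm (R : realType) (H : normedModType R) (ip : {dot H for idfun})
    (norm_ip : forall u : H, `|u| ^+ 2 = ip u u) (x y : H) :
  `|ip x y| <= `|x| * `|y|.
Proof.
have le_ip a b : ip a b <= `|a| * `|b|.
  have [->|a0] := eqVneq a 0; first by rewrite linear0l normr0 mul0r.
  have [->|b0] := eqVneq b 0; first by rewrite linear0r normr0 mulr0.
  (* The square expands to 2 |a| |b| (|a| |b| - (a, b)), and the positive factor can be
     cancelled. *)
  have := sqr_ge0 `| `|b| *: a - `|a| *: b |.
  rewrite norm_ip linearBl !linearBr !linearZl !linearZ /= -!norm_ip.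
  rewrite [ip b a]hermC /= expr0 mul1r => ge0.
  have [Pa Pb] : 0 < `|a| /\ 0 < `|b| by rewrite !normr_gt0.
  have : 0 <= (`|a| * `|b|) * (`|a| * `|b| - ip a b).
    by move: ge0; rewrite /GRing.scale /=; lra.
  by rewrite pmulr_rge0 ?mulr_gt0// subr_ge0.
rewrite ler_norml le_ip andbT lerNl.
by have := le_ip (- x) y; rewrite linearNl normrN.
Qed.

Lemma is_derive_line (R : realType) (H : normedModType R) (ip : {dot H for idfun})
    (f : H -> R) (Df : H -> H) (x d : H) (t : R) :
  is_diff (x + t *: d) f (ip (Df (x + t *: d))) ->
  is_derive t 1 (fun s : R => f (x + s *: d)) (ip (Df (x + t *: d)) d).
Proof.
move=> dfx.
have dl : is_diff t (fun s : R => x + s *: d) ( *:%R^~ d).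
  rewrite -[X in is_diff t _ X]add0r.
  exact: (@is_diffD R R H (cst x) ( *:%R^~ d) 0 ( *:%R^~ d) t
    (is_diff_cst x t) (is_diff_scalel t d)).
have dc : is_diff t (fun s : R => f (x + s *: d))
    (ip (Df (x + t *: d)) \o *:%R^~ d).
  exact: (@is_diff_comp _ _ _ _ (fun s : R => x + s *: d) _ f _ t dl dfx).
apply: DeriveDef; first by apply: diff_derivable; exact: ex_diff.
by rewrite deriveE ?diff_val /=; [rewrite scale1r|exact: ex_diff].
Qed.

Lemma diff_remainder (R : realType) (V W : normedModType R) (f df : V -> W)
    (x : V) (e : R) :
  is_diff x f df -> 0 < e ->
  \forall y \near x, `|f y - f x - df (y - x)| <= e * `|y - x|.
Proof.
move=> dfx e0.
have /diff_locallyP[_ /eqaddoP] := @ex_diff _ _ _ _ _ _ _ dfx.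
rewrite diff_val => /(_ _ e0) near0; rewrite (near_shift 0 x).
apply: filterS near0 => y /=.
by rewrite subr0 addrK !fctE /= opprD addrA.
Qed.

(** Along the segment, the slope of [f] falls below its value at [x] by at most L t^alpha
    |d|^(1+alpha), by Cauchy-Schwarz and the Hoelder bound. The term K t^(1+alpha) in [h] is the
    primitive of this defect, so [h] is nondecreasing, and comparing t = 0 with t = 1 gives the
    estimate. *)
Lemma holder_gradient_lower_bound (R : realType) (H : normedModType R)
    (ip : {dot H for idfun}) (norm_ip : forall u : H, `|u| ^+ 2 = ip u u)
    (f : H -> R) (Df : H -> H) (alpha L : R) (x y : H) :
  0 < alpha -> 0 <= L -> (forall u, is_diff u f (ip (Df u))) ->
  (forall t : R, 0 <= t <= 1 ->
    `|Df (x + t *: (y - x)) - Df x| <= L * `|t *: (y - x)| `^ alpha) ->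
  f x + ip (Df x) (y - x) - L / (1 + alpha) * `|y - x| `^ (1 + alpha) <= f y.
Proof.
move=> a0 L0 dff hol; set d := y - x in hol *.
have a1 : 0 < 1 + alpha by lra.
set K := L / (1 + alpha) * `|d| `^ (1 + alpha); set c := ip (Df x) d.
pose h t := f (x + t *: d) - t * c + K * t `^ (1 + alpha).
have dh (t : R) : 0 < t -> is_derive t 1 h
    (ip (Df (x + t *: d)) d - c + K * ((1 + alpha) * t `^ alpha)).
  move=> t0.
  have d1 := is_derive_line (dff (x + t *: d)).
  have d2 : is_derive t 1 (fun s : R => s * c) c.
    have := @is_deriveM _ _ id (cst c) t 1 1 0 (is_derive_id t 1) (is_derive_cst c t 1).
    by rewrite scaler0 add0r /GRing.scale /= mulr1.
  have d3 := is_derive1_powR (1 + alpha) t0.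
  rewrite addrAC subrr add0r in d3.
  have dB := is_deriveB d1 d2.
  have dZ := is_deriveZ K d3.
  exact: (is_deriveD dB dZ).
have dh_ge0 (t : R) : 0 < t -> t < 1 ->
    0 <= ip (Df (x + t *: d)) d - c + K * ((1 + alpha) * t `^ alpha).
  move=> t0 t1; rewrite /c -linearBl.
  have := dot_le_norm norm_ip (Df (x + t *: d) - Df x) d.
  rewrite ler_norml => /andP[+ _].
  have t01 : 0 <= t <= 1 by rewrite !ltW.
  have := hol t t01; rewrite normrZ (gtr0_norm t0) => D1.
  have -> : K * ((1 + alpha) * t `^ alpha) = L * (t * `|d|) `^ alpha * `|d|.
    rewrite powRM// ?ltW// /K powRD; last by rewrite gt_eqF.
    by rewrite powRr1//; field; rewrite gt_eqF.
  have := ler_wpM2r (normr_ge0 d) D1; lra.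
(* The derivative of the power is used at positive points only, so monotonicity is obtained on
   [s, 1] with s > 0. The point 0 is reached below by letting s tend to 0 from the right, after
   dropping the nonnegative power term from [h s]. *)
have mono (s : R) : 0 < s -> s <= 1 -> h s <= h 1.
  move=> s0 s1; apply: (@ger0_derive1_le_cc _ h s 1) => //.
  - move=> t; rewrite in_itv/= => /andP[st _].
    exact: (@ex_derive _ _ _ _ _ _ _ (dh t (lt_trans s0 st))).
  - move=> t; rewrite in_itv/= => /andP[st t1].
    have t0 := lt_trans s0 st.
    by rewrite derive1E (@derive_val _ _ _ _ _ _ _ (dh t t0)); exact: dh_ge0.
  - apply: derivable_within_continuous => t; rewrite in_itv/= => /andP[st _].
    exact: (@ex_derive _ _ _ _ _ _ _ (dh t (lt_le_trans s0 st))).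
  - by rewrite in_itv/= lexx.
  - by rewrite in_itv/= lexx andbT.
have h1 : h 1 = f y - c + K.
  by rewrite /h scale1r mul1r powR1 mulr1 [x + _]addrC subrK.
suff : f x <= h 1 by rewrite h1 /c; lra.
have K0 : 0 <= K by rewrite mulr_ge0 ?powR_ge0// divr_ge0// ltW.
have cvg0 : f (x + s *: d) - s * c @[s --> 0^'+] --> f x.
  have -> : f x = f (x + 0 *: d) - 0 * c by rewrite scale0r mul0r subr0 addr0.
  apply: cvg_at_right_filter; apply: cvgB; last by apply: cvgM => //; exact: cvg_cst.
  apply: (@differentiable_continuous _ _ _ 0 (fun s : R => f (x + s *: d))).
  by apply/derivable1_diffP; exact: (@ex_derive _ _ _ _ _ _ _ (is_derive_line (dff (x + 0 *: d)))).
apply: (cvgr_to_le cvg0); near=> s.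
have s0 : 0 < s by [].
apply: le_trans (mono s s0 _); last by near: s; exact: nbhs_right_le.
by rewrite /h lerDl mulr_ge0 ?powR_ge0.
Unshelve. all: by end_near. Qed.

(** * The Frechet subdifferential and its relation to the convex one *)

Lemma frechet_subdiffP (R : realType) (H : completeNormedModType R)
    (ip : {dot H for idfun}) (phi : H -> \bar R) (u xi : H) :
  (forall v, phi v != -oo%E) ->
  frechet_subdiff ip phi u xi <-> (phi u < +oo)%E /\
    forall e, 0 < e -> \forall v \near u,
      (phi u + (ip xi (v - u) - e * `|v - u|)%:E <= phi v)%E.
Proof.
move=> phiNy.
have quotE e v : phi u \is a fin_num -> v != u ->
    ((- e)%:E <= (phi v - phi u - (ip xi (v - u))%:E) * (`|v - u|^-1)%:E)%E =
    (phi u + (ip xi (v - u) - e * `|v - u|)%:E <= phi v)%E.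
  move=> ufin vu; rewrite lee_pdivlMr ?normr_gt0 ?subr_eq0//.
  rewrite -(fineK ufin); move: (phiNy v); case: (phi v) => [b| |] //= _; last by rewrite !addye// !leey.
  rewrite -EFinM -!EFinB -EFinD !lee_fin.
  by apply/idP/idP; lra.
split=> -[uoo sub]; split=> //.
  have ufin : phi u \is a fin_num by rewrite fin_numE phiNy lt_eqF.
  move=> e e0; move: sub; rewrite limf_einfE => sub.
  have : ((- e)%:E < ereal_sup [set ereal_inf
     ((fun v => (phi v - phi u - (ip xi (v - u))%:E) * (`|v - u|^-1)%:E) @` V)
      | V in u^'])%E by apply: lt_le_trans sub; rewrite lte_fin oppr_lt0.
  move=> /ereal_sup_gt[_ [V uV <-]] eV.
  move: uV; rewrite /dnbhs /within /= => uV.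
  (* The lower limit only sees the punctured neighbourhood; at v = u the inequality is an equality,
     so the neighbourhood can be taken full. *)
  near=> v; have [->|vu] := eqVneq v u.
    by rewrite subrr linear0r normr0 mulr0 subr0 adde0.
  rewrite -quotE//; apply: le_trans (ltW eV) _; apply: ereal_inf_lbound.
  by exists v => //; move: vu; near: v.
have ufin : phi u \is a fin_num by rewrite fin_numE phiNy lt_eqF.
rewrite limf_einfE; apply/lee_subgt0Pr => e e0; rewrite add0e.
apply: le_ereal_sup_tmp.
pose V := [set v | v != u /\
  (phi u + (ip xi (v - u) - e * `|v - u|)%:E <= phi v)%E].
exists (ereal_inf
  ((fun v => (phi v - phi u - (ip xi (v - u))%:E) * (`|v - u|^-1)%:E)%E @` V)).
  exists V => //; rewrite /dnbhs /within /=.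
  by apply: filterS (sub e e0) => v ? ?; split.
by apply: le_ereal_inf_tmp => _ [v [vu le] <-]; rewrite -EFinN quotE.
Unshelve. all: by end_near. Qed.

(* Along the segment from [u] to [v], convexity of [phi1] turns the first order
   Frechet inequality at [u] into the global one. *)
Lemma frechet_subdiff_convex (R : realType) (H : completeNormedModType R)
    (ip : {dot H for idfun}) (phi phi1 : H -> \bar R) (phi2 : H -> R)
    (u g xi : H) :
  (forall v, phi v = (phi1 v + (phi2 v)%:E)%E) ->
  (forall v, phi1 v != -oo%E) -> convex_efun phi1 ->
  is_diff u phi2 (ip g) ->
  frechet_subdiff ip phi u xi -> convex_subdiff ip phi1 u (xi - g).
Proof.
move=> phiE phi1Ny phi1_convex dphi2.
have phiNy v : phi v != -oo%E.
  by rewrite phiE; move: (phi1Ny v); case: (phi1 v).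
move=> /(frechet_subdiffP _ _ _ phiNy)[uoo sub].
have u1oo : (phi1 u < +oo)%E.
  by move: uoo; rewrite phiE; case: (phi1 u) => // r _; exact: ltry.
split => // v; move: (phi1Ny v) (phi1Ny u) u1oo.
case v1E : (phi1 v) => [b| |] //= _; last by rewrite leey.
case u1E : (phi1 u) => [a| |] //= _ _.
rewrite -EFinD lee_fin; apply/ler_addgt0Pr => e e0.
set d := v - u.
have c0 : 0 < 2 * (`|d| + 1) by have := normr_ge0 d; lra.
(* The error e' |d| is spent twice, on the Frechet inequality and on the differential of [phi2], and
   2 e' |d| = e |d| / (|d| + 1) <= e. Adding 1 to |d| keeps the denominator positive when d = 0. *)
pose e' := e / (2 * (`|d| + 1)).
have e'0 : 0 < e' by rewrite divr_gt0.
have line : u + t *: d @[t --> (0 : R)^'+] --> u.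
  rewrite -[X in _ --> X]addr0 -[X in _ --> _ + X](scale0r d).
  apply: cvg_at_right_filter; apply: cvgD; first exact: cvg_cst.
  exact: cvgZr_tmp.
have near1 := line _ (sub e' e'0).
have near2 := line _ (diff_remainder dphi2 e'0).
have [t [t0 t1 /= D1 D2]] : exists t : R, [/\ 0 < t, t <= 1,
   (phi u + (ip xi (u + t *: d - u) - e' * `|u + t *: d - u|)%R%:E
      <= phi (u + t *: d)%R)%E &
   `|phi2 (u + t *: d) - phi2 u - ip g (u + t *: d - u)|
      <= e' * `|u + t *: d - u| ].
  near (0 : R)^'+ => t; exists t; split => //.
  - by near: t; exact: nbhs_right_le.
  - by near: t; exact: near1.
  - by near: t; exact: near2.
have t01 : 0 <= t <= 1 by rewrite ltW.
have := phi1_convex v u t t01.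
have -> : t *: v + (1 - t) *: u = u + t *: d.
  by rewrite /d scalerBl scale1r scalerBr addrCA addrA.
rewrite v1E u1E -!EFinM -EFinD => D3.
have wu : u + t *: d - u = t *: d by rewrite addrAC subrr add0r.
have ipZ z : ip z (t *: d) = t * ip z d by rewrite linearZ.
rewrite !wu !ipZ normrZ (gtr0_norm t0) in D1 D2.
move: D1; rewrite !phiE u1E.
move: D3 (phi1Ny (u + t *: d)); case: (phi1 (u + t *: d)) => [c| |] //.
rewrite -!EFinD !lee_fin [ip (xi - g) d]linearBl => D3 _ D1.
move: D2; rewrite ler_norml => /andP[_ D2].
have D4 : t * (a + (ip xi d - ip g d)) <= t * (b + 2 * e' * `|d|) by lra.
rewrite ler_pM2l// in D4; apply: (le_trans D4).
rewrite lerD2l /e'.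
have -> : 2 * (e / (2 * (`|d| + 1))) * `|d| = e * (`|d| / (`|d| + 1)).
  by field; have := normr_ge0 d; rewrite gt_eqF; lra.
rewrite ger_pMr//; rewrite ler_pdivrMr; have := normr_ge0 d; lra.
Unshelve. all: by end_near. Qed.

(** * Compactness: uniform Hoelder constants and existence of minimizers *)

Lemma compact_segments (R : realType) (V : normedModType R) (A : set V) :
  compact A -> compact (segments A).
Proof.
move=> cA.
have -> : segments A =
    (fun p : (V * V) * R => p.2 *: p.1.1 + (1 - p.2) *: p.1.2) @`
      ((A `*` A) `*` `[0, 1]).
  apply/seteqP; split => [z [x [y [t [Ax Ay t01 ->]]]]|z [[[x y] t]]].
    by exists ((x, y), t) => //=; split => //=; rewrite in_itv.
  by move=> [[/= Ax Ay]]; rewrite /= in_itv => t01 <-; exists x, y, t.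
apply: continuous_compact; last first.
  by apply: compact_setX; [exact: compact_setX|exact: segment_compact].
apply: continuous_subspaceT => p.
have c1 : q.1.1 @[q --> p] --> p.1.1.
  by apply: (@cvg_comp _ _ _ fst fst); [exact: cvg_fst|exact: cvg_fst].
have c2 : q.1.2 @[q --> p] --> p.1.2.
  by apply: (@cvg_comp _ _ _ fst snd); [exact: cvg_fst|exact: cvg_snd].
have c3 : q.2 @[q --> p] --> p.2 by exact: cvg_snd.
apply: cvgD; first exact: cvgZ.
by apply: cvgZ => //; apply: cvgB => //; exact: cvg_cst.
Qed.

(* The estimate holds, with a constant that is locally uniform, near every
   point of [K * K]: off the diagonal by continuity, on the diagonal by the
   local Hoelder condition. *)
Lemma locally_holder_compact (R : realType) (V W : normedModType R)
    (alpha : R) (f : V -> W) (K : set V) :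
  0 < alpha -> compact K -> continuous f -> locally_holder alpha f ->
  exists L, holder_on K alpha L f.
Proof.
move=> a0 cK cf lf.
have /compact_near_coveringP cov := compact_setX cK cK.
have : \forall L \near +oo, (K `*` K) `<=` [set p : V * V |
    `|f p.1 - f p.2| <= L * `|p.1 - p.2| `^ alpha].
  apply: cov => -[x y] [/= Kx Ky].
  have [<-|xy] := eqVneq x y.
    have [U xU [L0 [L00 hL]]] := lf x.
    exists (U `*` U, [set L | L0 <= L]).
      split; [by exists (U, U)|by apply: nbhs_pinfty_ge; exact: num_real].
    move=> [[p q] L] /= [[Up Uq] L0L]; apply: (le_trans (hL _ _ Up Uq)).
    by rewrite ler_wpM2r// powR_ge0.
  (* Near (x, y) the distance of the two points stays above [m] and the increment of [f] below [M],
     so every L >= M / m^alpha works there. *)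
  pose m := `|x - y| / 2; pose M := `|f x - f y| + 1.
  have m0 : 0 < m by rewrite divr_gt0// normr_gt0 subr_eq0.
  have M0 : 0 < M by have := normr_ge0 (f x - f y); rewrite /M; lra.
  have cf1 : f p.1 @[p --> (x, y)] --> f x.
    by apply: (@cvg_comp _ _ _ fst f _ _ _ _ (cf x)); exact: cvg_fst.
  have cf2 : f p.2 @[p --> (x, y)] --> f y.
    by apply: (@cvg_comp _ _ _ snd f _ _ _ _ (cf y)); exact: cvg_snd.
  have near1 : \forall p \near (x, y), m < `|p.1 - p.2|.
    have c : `|p.1 - p.2| @[p --> (x, y)] --> `|x - y|.
      by apply: cvg_norm; apply: cvgB; [exact: cvg_fst|exact: cvg_snd].
    by apply: (cvgr_gt _ c); rewrite /m in m0 *; lra.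
  have near2 : \forall p \near (x, y), `|f p.1 - f p.2| < M.
    have c : `|f p.1 - f p.2| @[p --> (x, y)] --> `|f x - f y|.
      by apply: cvg_norm; exact: cvgB.
    by apply: (cvgr_lt _ c); rewrite /M; lra.
  exists ([set p | m < `|p.1 - p.2| /\ `|f p.1 - f p.2| < M],
          [set L | M / m `^ alpha <= L]).
    split; [exact: filterI|by apply: nbhs_pinfty_ge; exact: num_real].
  move=> [p L] /= [[mp pM]]; rewrite ler_pdivrMr ?powR_gt0// => ML.
  apply: (le_trans (ltW pM)); apply: (le_trans ML); rewrite ler_wpM2l//.
    by rewrite -(pmulr_lge0 _ (powR_gt0 alpha m0)); exact: le_trans (ltW M0) ML.
  by rewrite ge0_ler_powR ?nnegrE// ltW.
move=> hol; near (pinfty_nbhs R) => L; exists L; split.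
  by near: L; apply: nbhs_pinfty_ge; exact: num_real.
by move=> x y Kx Ky; apply: (near hol L _ (x, y)).
Unshelve. all: by end_near. Qed.

Lemma lower_semicontinuousD (R : realType) (T : topologicalType)
    (f : T -> \bar R) (g : T -> R) :
  (forall x, f x != -oo%E) -> lower_semicontinuous f -> continuous g ->
  lower_semicontinuous (fun x => f x + (g x)%:E)%E.
Proof.
move=> fNy lf cg x a afg.
(* A level [b] strictly between a - g x and f x splits the gap: [f] stays above [b] and [g] above a
   - b near [x]. If f x = +oo, any b > a - g x will do. *)
have [b ab bf] : exists2 b : R, a - g x < b & (b%:E < f x)%E.
  move: afg (fNy x); case: (f x) => [r| |] // afg _.
    move: afg; rewrite -EFinD lte_fin => afg.
    by exists ((a - g x + r) / 2); rewrite ?lte_fin; lra.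
  by exists (a - g x + 1); rewrite ?ltry //; lra.
have [V xV Vb] := lf x b bf.
have ng : \forall y \near x, a - b < g y.
  by apply: (cvgr_gt _ (cg x)); lra.
exists (V `&` [set y | a - b < g y]); first exact: filterI.
move=> y [/Vb + /=]; case: (f y) => [r| |] //; rewrite ?ltry//.
by rewrite -EFinD !lte_fin; lra.
Qed.

(** Without a minimizer, lower semicontinuity puts a whole neighbourhood of each point of [K]
    strictly above some value of [f] on [K]. The near-covering form of compactness, along the filter
    generated by the sublevels of [f] in [K], then gives a point of [K] with value strictly below
    that of every point of [K], itself included. *)
Lemma compact_lower_semicontinuous_min (R : realType) (T : topologicalType)
    (K : set T) (f : T -> \bar R) :
  compact K -> K !=set0 -> (forall x, f x != -oo%E) ->
  lower_semicontinuous f ->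
  exists2 x, K x & forall y, K y -> (f x <= f y)%E.
Proof.
move=> cK [x0 Kx0] fNy lf; apply: contrapT => nomin.
have lt_ex x : K x -> exists2 y, K y & (f y < f x)%E.
  move=> Kx; apply: contrapT => noy; apply: nomin; exists x => // y Ky.
  by rewrite leNgt; apply/negP => fyx; apply: noy; exists y.
pose F : set_system T :=
  [set S | exists2 y, K y & forall z, K z -> (f z <= f y)%E -> S z].
have FF : Filter F.
  split; first by exists x0.
    move=> P Q [y Ky yP] [z Kz zQ].
    have [fyz|/ltW fzy] := leP (f y) (f z).
      by exists y => // w Kw fwy; split; [exact: yP|apply: zQ => //; exact: le_trans fyz].
    by exists z => // w Kw fwz; split; [apply: yP => //; exact: le_trans fzy|exact: zQ].
  by move=> P Q PQ [y Ky yP]; exists y => // z Kz /(yP z Kz)/PQ.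
move/compact_near_coveringP : cK => /(_ T F (fun i x => (f i < f x)%E) FF)[].
  move=> x Kx; have [y Ky fyx] := lt_ex x Kx.
  move: (fyx) (fNy y); case fyE : (f y) => [r| |] // rx _; last first.
    by move: rx; rewrite ltNge leey.
  have [V xV Vr] := lf x r rx.
  exists (V, [set i | (f i <= f y)%E]); first by split => //=; exists y.
  by move=> [x' i] /= [Vx' fiy]; rewrite (le_lt_trans fiy)// fyE Vr.
by move=> y Ky /(_ y Ky (lexx _) y Ky); rewrite ltxx.
Qed.

(** * Convex functions on an interval and an extended intermediate value theorem *)

Lemma continuous_convex_lsc (R : realType) (f : R -> R) :
  (forall s t l : R, 0 <= s <= 1 -> 0 <= t <= 1 -> 0 <= l <= 1 ->
    f (l * s + (1 - l) * t) <= l * f s + (1 - l) * f t) ->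
  (forall s e : R, 0 <= s <= 1 -> 0 < e ->
    \forall t \near s, 0 <= t <= 1 -> f s - e < f t) ->
  {within `[0, 1], continuous f}.
Proof.
move=> cvx lsc; apply/subspace_continuousP => s /=; rewrite in_itv/= => s01.
(* Upper semicontinuity comes from convexity: for t between [s] and [z], the value f t lies below
   the chord, which tends to f s as t tends to [s]. It is applied with z = 1 on the right and z = 0
   on the left; if [s] is that endpoint, the corresponding side is empty. *)
have usc (z e : R) : 0 <= z <= 1 -> z != s -> 0 < e ->
    \forall t \near s, 0 <= (t - s) / (z - s) <= 1 -> f t < f s + e.
  move=> z01 zs e0.
  have c0 : (t - s) / (z - s) * (f z - f s) @[t --> s] --> 0.
    have c1 : t - s @[t --> s] --> 0.
      by apply/subr_cvg0.
    have c2 : (t - s) / (z - s) @[t --> s] --> 0.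
      by rewrite -[X in _ --> X](mul0r (z - s)^-1); exact: cvgMr_tmp.
    by rewrite -[X in _ --> X](mul0r (f z - f s)); exact: cvgMr_tmp.
  apply: filterS (cvgr_lt _ c0 _ e0) => t lte l01.
  have := cvx z s _ z01 s01 l01.
  have -> : (t - s) / (z - s) * z + (1 - (t - s) / (z - s)) * s = t.
    by field; rewrite subr_eq0.
  by move: lte; set l := (t - s) / (z - s); lra.
have uscs (e : R) : 0 < e -> \forall t \near s, 0 <= t <= 1 -> f t < f s + e.
  move=> e0.
  have n1 : \forall t \near s, s < t <= 1 -> f t < f s + e.
    have [s1|s1] := eqVneq 1 s.
      by near=> t => /andP[st t1]; move: st; rewrite -s1 ltNge t1.
    have := usc 1 e _ s1 e0; rewrite ler01 lexx => /(_ isT).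
    apply: filterS => t h /andP[st t1]; apply: h.
    have s1' : 0 < 1 - s by rewrite subr_gt0 lt_neqAle eq_sym s1; lra.
    by apply/andP; split; [apply: divr_ge0; lra|rewrite ler_pdivrMr// mul1r; lra].
  have n2 : \forall t \near s, 0 <= t < s -> f t < f s + e.
    have [s0|s0] := eqVneq 0 s.
      by near=> t => /andP[t0 ts]; move: ts; rewrite -s0 ltNge t0.
    have := usc 0 e _ s0 e0; rewrite ler01 lexx => /(_ isT).
    apply: filterS => t h /andP[t0 ts]; apply: h.
    have s0' : 0 < s by rewrite lt_neqAle s0; lra.
    have -> : (t - s) / (0 - s) = (s - t) / s by field; rewrite gt_eqF.
    by apply/andP; split; [apply: divr_ge0; lra|rewrite ler_pdivrMr// mul1r; lra].
  near=> t => /andP[t0 t1]; have [ts|st|->] := ltgtP t s; last by lra.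
    by apply: (near n2 t) => //; rewrite t0.
  by apply: (near n1 t) => //; rewrite st.
apply/cvgrPdist_lt => e e0; rewrite /within /=.
apply: filterS2 (lsc s e s01 e0) (uscs e e0) => t h1 h2; rewrite in_itv/= => t01.
by rewrite ltr_distlC; rewrite h1// h2.
Unshelve. all: by end_near. Qed.

(** Where the limit is +oo the truncation is eventually equal to [B]; where it is finite, [g] is
    eventually finite and continuity of the real minimum applies. *)
Lemma cvg_truncation (R : realType) (T : Type) (F : set_system T)
    (FF : Filter F) (g : T -> \bar R) (z : \bar R) (B : R) :
  (0 <= z)%E -> g x @[x --> F] --> z ->
  fine (Order.min (g x) B%:E) @[x --> F] --> fine (Order.min z B%:E).
Proof.
case: z => [r _ gr| _ goo |//]; last first.
  have -> : Order.min +oo%E B%:E = B%:E by rewrite minEle leye_eq.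
  apply: cvg_near_cst.
  by apply: filterS ((cvgey_ge goo) B) => x Bg; rewrite min_r.
have /fine_cvgP[gfin fgr] := gr.
rewrite -EFin_min /=.
have cmin : Num.min y B @[y --> r] --> Num.min r B.
  have := @continuous_min R R id (cst B) r; apply; first exact: cvg_id.
  exact: cvg_cst.
apply: cvg_trans (cvg_comp _ _ fgr cmin).
apply: near_eq_cvg; near=> x => /=.
have gx : g x \is a fin_num by near: x.
by rewrite -[in RHS](fineK gx) -EFin_min.
Unshelve. all: by end_near. Qed.

(* Truncating [g] at a level [B] with [f + c * B ^+ 2 > 0] makes the real
   intermediate value theorem applicable, and does not create zeros. *)
Lemma IVT_sqr_ereal (R : realType) (f : R -> R) (g : R -> \bar R) (c : R) :
  0 < c -> {within `[0, 1], continuous f} -> {within `[0, 1], continuous g} ->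
  (forall t, 0 <= g t)%E ->
  (exists2 r, g 0 = r%:E & f 0 + c * r ^+ 2 <= 0) ->
  (exists2 r, g 1 = r%:E & 0 <= f 1 + c * r ^+ 2) ->
  exists t r, [/\ 0 <= t <= 1, g t = r%:E & f t + c * r ^+ 2 = 0].
Proof.
move=> c0 cf cg g0 [r0 g0E f0] [r1 g1E f1].
have [m _ mmin] := EVT_min ler01 cf.
(* Since [m] minimizes [f] and B >= 1, one has c B^2 >= c B = c + |f m| > - f t on the whole
   interval. *)
pose B := 1 + `|f m| / c.
have B1 : 1 <= B by rewrite lerDl divr_ge0// ltW.
have fB t : 0 <= t <= 1 -> 0 < f t + c * B ^+ 2.
  move=> t01; have := mmin t; rewrite in_itv/= => /(_ t01) fmt.
  have cB : c * B = c + `|f m| by rewrite /B; field; rewrite gt_eqF.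
  have : c * B <= c * B ^+ 2 by rewrite ler_pM2l// expr2 ler_peMl//; lra.
  have := ler_norm (- f m); rewrite normrN; lra.
pose k t := fine (Order.min (g t) B%:E).
have kE t r : g t = r%:E -> k t = Num.min r B by rewrite /k => ->; rewrite -EFin_min.
have ck : {within `[0, 1], continuous k}.
  apply/subspace_continuousP => t t01.
  move/subspace_continuousP : cg => /(_ t t01) cgt.
  exact: cvg_truncation.
pose h t := f t + c * k t ^+ 2.
have ch : {within `[0, 1], continuous h}.
  move=> t; apply: cvgD; first exact: cf.
  by apply: cvgM; [exact: cvg_cst|apply: cvgM; exact: ck].
have [| t t01 ht] := @IVT R h 0 1 0 ler01 ch.
  have h0 : h 0 <= 0.
    apply: le_trans f0; rewrite /h (kE _ _ g0E) lerD2l ler_pM2l//.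
    have r0_ge0 : 0 <= r0 by rewrite -lee_fin -g0E.
    apply: lerXn2r; rewrite ?nnegrE ?le_min ?r0_ge0 ?ge_min ?lexx//=; lra.
  have h1 : 0 <= h 1.
    rewrite /h (kE _ _ g1E); have [//|_] := leP r1 B.
    by rewrite ltW// fB// ler01 lexx.
  by rewrite ge_min h0 le_max h1 orbT.
rewrite in_itv/= in t01.
(* At a zero of [h] the truncation is inactive, so g t is finite and equal to k t. *)
have kB : k t != B.
  by apply/eqP => ktB; have := fB t t01; rewrite -ktB -/(h t) ht ltxx.
move: kB ht; rewrite /h /k; have := g0 t; case gtE : (g t) => [r| |] // r_ge0.
  rewrite -EFin_min /=; have [rB _ hr|_ /eqP//] := leP r B.
  by exists t, r.
by rewrite [Order.min _ _]minEle leye_eq /= eqxx.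
Qed.

(** * The implicit Euler step: existence, optimality condition and energy estimate *)

Lemma subgradE (R : realType) (H : completeNormedModType R)
    (ip : {dot H for idfun}) (phi phi1 : H -> \bar R) (phi2 : H -> R)
    (u g xi : H) :
  (forall v, phi v = (phi1 v + (phi2 v)%:E)%E) ->
  (forall v, phi1 v != -oo%E) -> convex_efun phi1 ->
  single_valued (convex_subdiff ip phi1) -> is_diff u phi2 (ip g) ->
  frechet_subdiff ip phi u xi -> subgrad ip phi u = xi.
Proof.
move=> phiE phi1Ny cvx single dphi2 uxi.
have conv := frechet_subdiff_convex phiE phi1Ny cvx dphi2.
have [eta etaE] := single u (ex_intro _ _ (conv _ uxi)).
(* Translation by -g sends every Frechet subgradient into the singleton subdifferential of [phi1];
   hence there is only one, and [xget] must return it. *)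
have etaP z : frechet_subdiff ip phi u z -> z = eta + g.
  by move/conv; rewrite etaE => <-; rewrite subrK.
by rewrite (etaP _ uxi); apply: etaP; exact: (xgetI _ uxi).
Qed.

(** Minimizing over the compact sublevel of [u0] is enough: outside it [phi] alone already exceeds
    phi u0, which is the value of the penalized functional at [u0]. *)
Lemma proximal_exists (R : realType) (H : completeNormedModType R)
    (phi : H -> \bar R) (u0 : H) (c : R) :
  compact_sublevels phi -> (forall v, phi v != -oo%E) ->
  lower_semicontinuous phi -> phi u0 \is a fin_num -> 0 <= c ->
  exists2 u, (phi u <= phi u0)%E & forall v,
    (phi u + (c * `|u - u0| ^+ 2)%:E <= phi v + (c * `|v - u0| ^+ 2)%:E)%E.
Proof.
move=> cphi phiNy lphi fin0 c0.
pose psi v := (phi v + (c * `|v - u0| ^+ 2)%:E)%E.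
have psiNy v : psi v != -oo%E by rewrite /psi; move: (phiNy v); case: (phi v).
have lpsi : lower_semicontinuous psi.
  apply: lower_semicontinuousD => // v.
  apply: cvgMl_tmp; apply: (@cvgM _ _ _ _ (fun w => `|w - u0|) (fun w => `|w - u0|)).
    by apply: cvg_norm; apply: cvgB; [exact: cvg_id|exact: cvg_cst].
  by apply: cvg_norm; apply: cvgB; [exact: cvg_id|exact: cvg_cst].
have K0 : [set v | phi v <= (fine (phi u0))%:E]%E u0 by rewrite /= fineK.
have [u Ku umin] := compact_lower_semicontinuous_min (cphi _)
  (ex_intro _ _ K0) psiNy lpsi.
rewrite /= fineK// in Ku; exists u => // v.
have [vK|vK] := leP (phi v) (phi u0); first by apply: umin; rewrite /= fineK.
apply: (le_trans (umin _ K0)).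
rewrite /psi subrr normr0 expr0n mulr0 adde0.
by apply: le_trans (ltW vK) _; rewrite leeDl// lee_fin mulr_ge0// sqr_ge0.
Qed.

(** Expanding |v - u0|^2 around [u], the cross term is the pairing with the subgradient, and the
    remainder |v - u|^2 / (2 tau) is at most e |v - u| once |v - u| <= 2 tau e. *)
Lemma proximal_frechet_subdiff (R : realType) (H : completeNormedModType R)
    (ip : {dot H for idfun}) (norm_ip : forall u : H, `|u| ^+ 2 = ip u u)
    (phi : H -> \bar R) (tau : R) (u0 u : H) :
  0 < tau -> (forall v, phi v != -oo%E) -> (phi u < +oo)%E ->
  (forall v, phi u + ((tau *+ 2)^-1 * `|u - u0| ^+ 2)%:E
    <= phi v + ((tau *+ 2)^-1 * `|v - u0| ^+ 2)%:E)%E ->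
  frechet_subdiff ip phi u (tau^-1 *: (u0 - u)).
Proof.
move=> tau0 phiNy uoo umin; apply/frechet_subdiffP => //; split=> // e e0.
have te0 : 0 < tau * 2 * e by rewrite !mulr_gt0.
near=> v.
have small : `|v - u| <= tau * 2 * e.
  rewrite distrC; apply: ltW; near: v.
  by apply: (@cvgr_dist_lt _ _ _ _ _ id u _ _ te0); exact: cvg_id.
have expand : `|v - u0| ^+ 2 = `|u - u0| ^+ 2 - 2 * ip (u0 - u) (v - u) + `|v - u| ^+ 2.
  have -> : v - u0 = (v - u) - (u0 - u) by rewrite opprB addrA subrK.
  rewrite (distrC u); move: (v - u) (u0 - u) => w d.
  rewrite !norm_ip linearBl !linearBr /= [ip w d]hermC /= expr0 mul1r; ring.
have := umin v; move: (phiNy v) (phiNy u) uoo; rewrite expand.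
case: (phi v) => [b| |] //= _; last by move=> *; rewrite leey.
case: (phi u) => [a| |] //= _ _.
rewrite -!EFinD !lee_fin [ip (_ *: _) _]linearZl /= => le1.
have n0 := normr_ge0 (v - u).
set N := `|v - u| in small n0 le1 *; set I := ip _ _ in le1 *.
have -> : tau^-1 * I = (tau *+ 2)^-1 * (2 * I) by field; rewrite gt_eqF.
have rN : (tau *+ 2)^-1 * N <= e.
  by rewrite ler_pdivrMl ?pmulrn_lgt0//; move: small; lra.
have := ler_wpM2r n0 rN; move: le1; set r := (tau *+ 2)^-1; lra.
Unshelve. all: by end_near. Qed.

(* Summing the subgradient inequality for [phi1] and the Hoelder estimate for
   [phi2], both based at the new point, gives twice the usual dissipation
   [|u - u0|^2 / (2 tau)]; half of it is [tau / 2 * |subgrad u|^2]. *)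
Lemma proximal_energy (R : realType) (H : completeNormedModType R)
    (ip : {dot H for idfun}) (norm_ip : forall u : H, `|u| ^+ 2 = ip u u)
    (phi phi1 : H -> \bar R) (phi2 : H -> R) (Dphi2 : H -> H)
    (alpha L tau : R) (u0 u : H) :
  (forall v, phi v = (phi1 v + (phi2 v)%:E)%E) ->
  (forall v, phi1 v != -oo%E) -> convex_efun phi1 ->
  single_valued (convex_subdiff ip phi1) ->
  (forall v, is_diff v phi2 (ip (Dphi2 v))) ->
  0 < alpha -> 0 < tau -> phi u0 \is a fin_num ->
  holder_on (segments [set v | phi v <= phi u0]%E) alpha L Dphi2 ->
  (phi u <= phi u0)%E ->
  frechet_subdiff ip phi u (tau^-1 *: (u0 - u)) ->
  (G ip phi tau u u0 <= (L / (1 + alpha) * `|u - u0| `^ (1 + alpha))%:E)%E.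
Proof.
move=> phiE phi1Ny cvx single dphi2 a0 tau0 fin0 [L0 hol] uu0 uxi.
(* Both [u] and [u0] lie in the sublevel of [u0], so the segment between them lies in the set where
   the Hoelder bound holds; its base point [u] is a degenerate segment. *)
have seg (t : R) : 0 <= t <= 1 ->
    `|Dphi2 (u + t *: (u0 - u)) - Dphi2 u| <= L * `|t *: (u0 - u)| `^ alpha.
  move=> t01; rewrite -[in leRHS](addrK u (t *: _)) [t *: _ + u]addrC.
  apply: hol.
    exists u0, u, t; split => //=.
    by rewrite scalerBr scalerBl scale1r addrCA addrA.
  by exists u, u, t; split => //=; rewrite -scalerDl addrC subrK scale1r.
have [_ /(_ u0)] := frechet_subdiff_convex phiE phi1Ny cvx (dphi2 u) uxi.
have := holder_gradient_lower_bound norm_ip a0 L0 dphi2 seg.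
rewrite /G (subgradE phiE phi1Ny cvx single (dphi2 u) uxi).
move: uxi => [uoo _]; move: fin0 uoo; rewrite !phiE.
move: (phi1Ny u) (phi1Ny u0).
case: (phi1 u) => [a| |] //; case: (phi1 u0) => [b| |] // _ _ _ _.
rewrite -?EFinD -?EFinB !lee_fin [ip (_ - _) _]linearBl /= [ip (_ *: _) _]linearZl /=.
rewrite -norm_ip !normrZ (distrC u0 u) gtr0_norm ?invr_gt0//.
set N := `|u - u0|; set C := L / _ * _ => h1 h2.
have -> : (tau^-1 * N) ^+ 2 = tau^-1 * (tau^-1 * N ^+ 2) by ring.
rewrite !(mulrA (tau / 2)) (_ : tau / 2 / tau = 2^-1); first by lra.
by field; rewrite gt_eqF.
Qed.

(** * The convex case: a zero of G on a segment *)

Lemma gradient_cst (R : realType) (H : completeNormedModType R)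
    (ip : {dot H for idfun}) (norm_ip : forall u : H, `|u| ^+ 2 = ip u u)
    (f : H -> R) (u g : H) :
  (forall v, f v = 0) -> is_diff u f (ip g) -> g = 0.
Proof.
move=> f0 df; have fE : f = cst 0 by apply/funext.
have := @diff_val _ _ _ _ _ _ _ df; rewrite fE diff_cst => /(congr1 (@^~ g)) /= gg.
by apply/normr0_eq0/eqP; rewrite -sqrf_eq0 norm_ip -gg.
Qed.

Lemma segment_G_eq0 (R : realType) (H : completeNormedModType R)
    (ip : {dot H for idfun}) (phi : H -> \bar R) (tau : R) (u0 u : H) :
  0 < tau -> (forall v, phi v != -oo%E) -> convex_efun phi ->
  lower_semicontinuous phi ->
  dom_subdiff ip phi u0 -> dom_subdiff ip phi u ->
  {within `[0, 1], continuous (fun l : R =>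
    subgrad_norm ip phi (l *: u0 + (1 - l) *: u))} ->
  (G ip phi tau u u0 <= 0)%E ->
  exists2 w, dom_subdiff ip phi w & G ip phi tau w u0 = 0%E.
Proof.
move=> tau0 phiNy cvx lphi dom0 domu cg Gle0.
pose w (l : R) := l *: u0 + (1 - l) *: u.
have w0 : w 0 = u by rewrite /w scale0r add0r subr0 scale1r.
have w1 : w 1 = u0 by rewrite /w scale1r subrr scale0r addr0.
have cw : continuous w.
  move=> l; apply: cvgD; apply: cvgZr_tmp; first exact: cvg_id.
  by apply: cvgB; [exact: cvg_cst|exact: cvg_id].
have finE v : (phi v < +oo)%E -> exists r, phi v = r%:E.
  by move: (phiNy v); case: (phi v) => [r| |] // _ _; exists r.
have [[xi0 [/finE[b bE] _]] [xiu [/finE[a aE] _]]] := (dom0, domu).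
have phiw l : 0 <= l <= 1 -> phi (w l) \is a fin_num.
  move=> l01; rewrite fin_numE phiNy -ltey (le_lt_trans (cvx _ _ _ l01))//.
  by rewrite bE aE -!EFinM -EFinD ltry.
pose p l := fine (phi (w l)).
have pE l : 0 <= l <= 1 -> phi (w l) = (p l)%:E by move=> /phiw/fineK.
(* On the segment [phi] is finite, convex and lower semicontinuous, hence continuous up to the
   endpoints. *)
have cp : {within `[0, 1], continuous p}.
  apply: continuous_convex_lsc => [s t l s01 t01 l01|s e s01 e0].
    have lst01 : 0 <= l * s + (1 - l) * t <= 1 by nra.
    rewrite -lee_fin -pE// EFinD !EFinM -!pE//.
    have -> : w (l * s + (1 - l) * t) = l *: w s + (1 - l) *: w t.
      rewrite /w !scalerDr !scalerA addrACA -scalerDl; congr (_ + _).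
      by rewrite -scalerDl; congr (_ *: _); ring.
    exact: cvx.
  have lt : ((p s - e)%:E < phi (w s))%E by rewrite pE// lte_fin; lra.
  have [V wV Vlt] := lphi _ _ lt.
  have nearV : \forall t \near s, V (w t) by exact: cw s _ wV.
  by apply: filterS nearV => t /Vlt + t01; rewrite pE// lte_fin.
pose f l := p l + tau / 2 * `|tau^-1 *: (w l - u0)| ^+ 2 - b.
have cf : {within `[0, 1], continuous f}.
  have cn : continuous (fun l => `|tau^-1 *: (w l - u0)|).
    move=> l; apply: cvg_norm; apply: cvgZl_tmp.
    by apply: cvgB; [exact: cw|exact: cvg_cst].
  apply: within_continuousB; last by apply: continuous_subspaceT => l; exact: cvg_cst.
  apply: within_continuousD => //; apply: continuous_subspaceT => l.
  by apply: cvgMl_tmp; rewrite expr2; apply: cvgM; exact: cn.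
(* A finite value of [subgrad_norm] certifies membership in the domain, so the zero found below is
   automatically a point where G is meaningful. *)
have GE l r : 0 <= l <= 1 -> subgrad_norm ip phi (w l) = r%:E ->
    dom_subdiff ip phi (w l) /\
    G ip phi tau (w l) u0 = (f l + tau / 2 * r ^+ 2)%:E.
  rewrite /subgrad_norm; move=> l01; case: asboolP => [dom [rE]|_ []//].
  split=> //.
  by rewrite /G bE pE// rE -!EFinD /f [in RHS]addrAC.
have gnum v : dom_subdiff ip phi v ->
    subgrad_norm ip phi v = `|subgrad ip phi v|%:E.
  by move=> dom; rewrite /subgrad_norm asboolT.
have [||||||t [r [t01 gt ft]]] :=
  @IVT_sqr_ereal R f (fun l => subgrad_norm ip phi (w l)) (tau / 2).
- by rewrite divr_gt0.
- exact: cf.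
- exact: cg.
- by move=> t; rewrite /subgrad_norm; case: ifP; rewrite ?leey ?lee_fin.
- have g0 : subgrad_norm ip phi (w 0) = `|subgrad ip phi u|%:E.
    by rewrite w0 gnum.
  have i01 : 0 <= (0 : R) <= 1 by rewrite lexx ler01.
  exists `|subgrad ip phi u| => //; have [_ GuE] := GE 0 _ i01 g0.
  by rewrite -lee_fin -GuE w0.
(* At [u0] the energy difference and the step term vanish, which leaves tau / 2 times the squared
   norm of the subgradient. *)
- exists `|subgrad ip phi u0|; first by rewrite w1 gnum.
  rewrite /f /p w1 bE subrr scaler0 normr0 /= expr0n mulr0 addr0 subrr add0r.
  by rewrite mulr_ge0 ?sqr_ge0// divr_ge0// ltW.
have [domw GwE] := GE t r t01 gt.
by exists (w t); rewrite // GwE ft.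
Qed.

Theorem theorem4p1 (R : realType) (H : completeNormedModType R)
    (ip : {dot H for idfun})
    (norm_ip : forall u : H, `|u| ^+ 2 = ip u u)
    (sepH : separable_space H)
    (phi phi1 : H -> \bar R) (phi2 : H -> R) (Dphi2 : H -> H) (alpha : R)
    (phiE : forall u, phi u = (phi1 u + (phi2 u)%:E)%E)
    (phi_compact : compact_sublevels phi)
    (phi1_convex : convex_efun phi1)
    (phi1_proper : proper_fun phi1)
    (phi1_lsc : lower_semicontinuous phi1)
    (phi1_single : single_valued (convex_subdiff ip phi1))
    (alpha_range : 0 < alpha <= 1)
    (phi2_C1 : C1holder_loc ip alpha phi2 Dphi2)
    (tau : R) (tau_gt0 : 0 < tau)
    (u0 : H) (u0_dom : dom_subdiff ip phi u0)
    (u0_ncrit : subgrad ip phi u0 != 0) :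
  (* [is_const L]: L is a Hoelder constant of D phi2, on the segments joining
     the points of the compact sublevel of [u0] *)
  let is_const (L : R) :=
    holder_on (segments [set u | (phi u <= phi u0)%E]) alpha L Dphi2 in
  [/\ exists L, is_const L,
      exists u : H,
        [/\ dom_subdiff ip phi u,
            u != u0,
            forall L, is_const L ->
              (G ip phi tau u u0
                 <= (L / (1 + alpha) * `|u - u0| `^ (1 + alpha))%:E)%E
          & exists rho : R,
              (phi u + (tau / 2 * `|tau^-1 *: (u - u0)| ^+ 2)%:E
                     + (tau / 2 * `|subgrad ip phi u| ^+ 2)%:E
                 = phi u0 + rho%:E)%E /\
              forall L, is_const L ->
                rho <= L * `|u - u0| `^ (1 + alpha) / (1 + alpha)]
    & (forall u, phi2 u = 0) ->
      (forall x y, dom_subdiff ip phi x -> dom_subdiff ip phi y ->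
         {within `[0, 1], continuous (fun l : R =>
            subgrad_norm ip phi (l *: x + (1 - l) *: y))}) ->
      exists2 u : H, dom_subdiff ip phi u & G ip phi tau u u0 = 0%E].
Proof.
move=> is_const.
have [/andP[a0 _] [dphi2 cDphi2 hDphi2]] := (alpha_range, phi2_C1).
have [phi1Ny _] := phi1_proper.
have phiNy v : phi v != -oo%E by rewrite phiE; move: (phi1Ny v); case: (phi1 v).
have [xi0 [u0oo _]] := u0_dom.
have fin0 : phi u0 \is a fin_num by rewrite fin_numE phiNy lt_eqF.
have cphi2 : continuous phi2.
  by move=> v; apply: differentiable_continuous; exact: (@ex_diff _ _ _ _ _ _ _ (dphi2 v)).
have phi_lsc : lower_semicontinuous phi.
  by rewrite (_ : phi = fun v => phi1 v + (phi2 v)%:E)%E; [exact: lower_semicontinuousD|apply/funext].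
have c0 : 0 <= (tau *+ 2)^-1 by rewrite invr_ge0 mulrn_wge0// ltW.
have [u uu0 umin] := proximal_exists phi_compact phiNy phi_lsc fin0 c0.
have uoo := le_lt_trans uu0 u0oo.
have uxi := proximal_frechet_subdiff norm_ip tau_gt0 phiNy uoo umin.
have udom : dom_subdiff ip phi u by exists (tau^-1 *: (u0 - u)).
have Gle L : is_const L ->
    (G ip phi tau u u0 <= (L / (1 + alpha) * `|u - u0| `^ (1 + alpha))%:E)%E.
  by move=> hol; apply: (proximal_energy norm_ip phiE phi1Ny phi1_convex phi1_single dphi2).
split.
- apply: locally_holder_compact => //; apply: compact_segments.
  by rewrite -(fineK fin0); exact: phi_compact.
- exists u; split => //.
    (* If the step did not move, its subgradient (u0 - u) / tau would be 0, and [u0] would be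
       critical. *)
    apply: contra_neq u0_ncrit => uE; rewrite uE in uxi.
    rewrite (subgradE phiE phi1Ny phi1_convex phi1_single (dphi2 u0) uxi).
    by rewrite subrr scaler0.
  have ufin : phi u \is a fin_num by rewrite fin_numE phiNy lt_eqF.
  (* The residual is the value of G itself, finite because phi u and phi u0 are. *)
  exists (fine (G ip phi tau u u0)); split.
    by rewrite /G -(fineK ufin) -(fineK fin0) -!EFinD /= addrCA subrr addr0.
  move=> L /Gle; rewrite /G -(fineK ufin) -(fineK fin0) -!EFinD lee_fin => GL.
  by apply: (le_trans GL); rewrite [leRHS]mulrAC.
move=> phi20 norm_cont.
have phiE1 : phi = phi1 by apply/funext => v; rewrite phiE phi20 adde0.
apply: (segment_G_eq0 tau_gt0 phiNy _ phi_lsc u0_dom udom) => //.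
- by rewrite phiE1.
- exact: norm_cont.
(* With [phi2] equal to 0 its gradient vanishes, so L = 0 is an admissible constant and G is
   nonpositive at the Euler step. *)
have := Gle 0; rewrite !mul0r; apply; split => // x y _ _.
by rewrite !(gradient_cst norm_ip phi20 (dphi2 _)) subrr normr0 mul0r.
Qed.
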